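(* Let $\Theta_0=B_0^{-1}=(\theta_{ij})$, $\theta_{\max}=\max_j\theta_{jj}$, suppose Assumption (A1) (see context) holds, that $A_0\succ0$ and $\|A_0\|_2<\infty$. Let $d_0$ be the maximum row sparsity (maximum number of nonzero entries in a row) of $\Theta_0$, and suppose $\underline{r_{\mathrm{offd}}}\sqrt{d_0}=o(1)$ as $n\to\infty$. Suppose that, for absolute constants $C_{\max},c_\gamma$, $$\|\hat B^\star-B_0\|_{\max}\le C_{\max}\,b_\infty\,\underline{r_{\mathrm{offd}}},$$ $$\forall j\in[n]:\qquad \|\hat\gamma^{(j)}-\hat\Gamma^{(j)}\beta^{j*}\|_\infty\le c_\gamma\,b_\infty\,\kappa_\rho\,\underline{r_{\mathrm{offd}}}\le\lambda/4,$$ where the penalty is set as $\lambda\asymp 4C_\gamma\, b_\infty\,\tilde\kappa_\rho\,\underline{r_{\mathrm{offd}}}$ with $C_\gamma\ge c_\gamma\vee C_{\max}$. Suppose the Lower-RE condition holds uniformly over the matrices $\hat\Gamma^{(j)}$, $j\in[n]$, with curvature $\alpha$ and tolerance $\tau$, i.e. $v^T\hat\Gamma^{(j)}v\ge\alpha\|v\|_2^2-\tau|v|_1^2$ for all $v\in\mathbb{R}^{n-1}$ and all $j\in[n]$, where $$\alpha\asymp\lambda_{\min}(B_0),\qquad \alpha/\tau\ge120\,d_0,\qquad \lambda/\tau\ge4b_1,$$ and $b_1\ge|\beta^{j*}|_1$ for all $j\in[n]$. Then, for the estimator $\hat\Theta$ constructed in the context with these $\lambda,b_1$, for some absolute constant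 $c_{\mathrm{overall}}$ (and $n$ sufficiently large), $$\|\hat\Theta-\Theta_0\|_1\ \le\ c_{\mathrm{overall}}\,\|\Theta_0\|_2\,b_\infty\,\tilde\kappa_\rho\,\theta_{\max}\,\kappa_B\,\underline{r_{\mathrm{offd}}}\,d_0.$$
   Context: Notation: $[n]=\{1,\dots,n\}$; $x\vee y=\max(x,y)$; for vectors $\|\cdot\|_2$ is the Euclidean norm, $|v|_1=\sum|v_i|$, $\|v\|_\infty=\max|v_i|$; for matrices $\|\cdot\|_2$ is the operator norm, $\|\cdot\|_1$ the maximum absolute column sum, $\|\cdot\|_\infty$ the maximum absolute row sum, $\|\cdot\|_{\max}$ the maximum absolute entry; $\circ$ is the Hadamard product, $\oslash$ componentwise division ($0/0=0$). $a\asymp b$ means $c\,a\le b\le C\,a$ for positive absolute constants; $c_{\mathrm{overall}}$ may depend on the absolute constants $C_{\max},c_\gamma,C_\gamma$ and those implicit in $\asymp$. The result is deterministic: it holds for any realization of the data for which the listed conditions hold. Data: $A_0=(a_{ij})\in\mathbb{R}^{m\times m}$, $B_0=(b_{ij})\in\mathbb{R}^{n\times n}$ symmetric positive definite, $\mathrm{tr}(B_0)=n$; $\mathcal{X}=U\circ X$ with $X=B_0^{1/2}\mathbb{Z}A_0^{1/2}$ an $n\times m$ data matrix ($\mathbb{Z}$ with independent mean-zero unit-variance subgaussian entries) and $U\in\{0,1\}^{n\times m}$ an independent mask with independent entries, those in column $j$ Bernoulli with mean $p_j$. $\hat B^\star=\mathcal{X}\mathcal{X}^T\oslash\hat{\mathbb{M}}$,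 where $\hat p_j=\frac1n\sum_{k=1}^nU_{kj}$, $\hat M_{ii}=\hat p_i$, $\hat M_{ij}=\hat p_i\hat p_j$ ($i\ne j$), and $\hat{\mathbb{M}}\in\mathbb{R}^{n\times n}$ has diagonal entries $\frac1n\mathrm{tr}(\mathcal{X}^T\mathcal{X})$ and off-diagonal entries $\frac1{n-1}\mathrm{tr}(\mathcal{X}^T\mathcal{X}\circ\hat M)-\frac1{n(n-1)}\mathrm{tr}(\mathcal{X}^T\mathcal{X})$. For $j\in[n]$: $\hat\Gamma^{(j)}=\hat B^\star_{-j,-j}\in\mathbb{R}^{(n-1)\times(n-1)}$ ($\hat B^\star$ with row and column $j$ removed), $\hat\gamma^{(j)}=\hat B^\star_{-j,j}\in\mathbb{R}^{n-1}$ (column $j$ without its $j$th entry), and $\beta^{j*}=(\beta^{j*}_k)_{k\ne j}$ with $\beta^{j*}_k=-\theta_{jk}/\theta_{jj}$. Construction of $\hat\Theta$: (1) for each $j$, $\hat\beta^{(j)}\in\arg\min\{\frac12\beta^T\hat\Gamma^{(j)}\beta-\langle\hat\gamma^{(j)},\beta\rangle+\lambda|\beta|_1:\ \beta\in\mathbb{R}^{n-1},\ |\beta|_1\le b_1\}$, for penalty $\lambda>0$ and radius $b_1>0$; (2) $\tilde\Theta_{jj}=(\hat B^\star_{jj}-\hat B^\star_{j,-j}\hat\beta^{(j)})^{-1}$ and $\tilde\Theta_{j,-j}=-\tilde\Theta_{jj}\hat\beta^{(j)}$ (the $j$th row of $\tilde\Theta$ without its diagonal entry); (3) $\hat\Theta\in\arg\min_\Theta\|\Theta-\tilde\Theta\|_\infty$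 over symmetric $n\times n$ matrices $\Theta$. $a_\infty=\max_ja_{jj}$, $a_{\min}=\min_ja_{jj}$, $\eta_A=\sqrt{a_\infty/a_{\min}}$, $b_\infty=\max_jb_{jj}$, $\kappa_B=\|B_0\|_2/\lambda_{\min}(B_0)$, $\underline{r_{\mathrm{offd}}}=\eta_A\big(\|A_0\|_2\log(m\vee n)/\sum_{j=1}^m a_{jj}p_j^2\big)^{1/2}$. Assumption (A1): let $W=\mathrm{diag}(b_{11}^{1/2},\dots,b_{nn}^{1/2})$ (with bounded positive entries), $\rho(B)=W^{-1}B_0W^{-1}$, $\Omega=\rho(B)^{-1}$; then $1\le\|\rho(B)\|_2\le M_\rho$ and $1\le\|\Omega\|_2\le M_\Omega$. Put $\kappa_\rho=\|\rho(B)\|_2\|\Omega\|_2$ and $\tilde\kappa_\rho=M_\rho M_\Omega$. *)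

(* Defs.v *)
From mathcomp Require Export all_boot all_order all_algebra.
From mathcomp Require Export all_classical all_reals all_analysis.
Export Order.TTheory GRing.Theory Num.Theory.
Export numFieldNormedType.Exports.

Set Implicit Arguments.
Unset Strict Implicit.
Unset Printing Implicit Defensive.

Local Open Scope classical_set_scope.
Local Open Scope ring_scope.

(** Norms.  The maximum absolute entry of a matrix or vector is the norm
    [`|_|] that MathComp-Analysis puts on matrices; the other norms are: *)

Definition vnorm1 (R : realType) n (v : 'cV[R]_n) : R := \sum_i `|v i 0|.

Definition vnorm2 (R : realType) n (v : 'cV[R]_n) : R :=
  Num.sqrt (\sum_i v i 0 ^+ 2).

Definition opnorm2 (R : realType) m n (M : 'M[R]_(m, n)) : R :=
  sup [set vnorm2 (M *m v) | v in [set v : 'cV[R]_n | vnorm2 v <= 1]].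

Definition mxnorm1 (R : realType) m n (M : 'M[R]_(m, n)) : R :=
  \big[Num.max/0]_(j < n) \sum_(i < m) `|M i j|.

Definition mxnorm_oo (R : realType) m n (M : 'M[R]_(m, n)) : R :=
  \big[Num.max/0]_(i < m) \sum_(j < n) `|M i j|.

Definition dotp (R : realType) n (u v : 'cV[R]_n) : R := \sum_i u i 0 * v i 0.

Definition symmx (R : realType) n (M : 'M[R]_n) : Prop := M^T = M.

Definition qform (R : realType) n (M : 'M[R]_n) (v : 'cV[R]_n) : R :=
  dotp v (M *m v).

Definition posdef (R : realType) n (M : 'M[R]_n) : Prop :=
  symmx M /\ forall v : 'cV[R]_n, v != 0 -> 0 < qform M v.

Definition possemidef (R : realType) n (M : 'M[R]_n) : Prop :=
  symmx M /\ forall v : 'cV[R]_n, 0 <= qform M v.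

(* The symmetric square root M^(1/2); 0 if M is not positive semidefinite. *)
Definition sqrtmx (R : realType) n (M : 'M[R]_n) : 'M[R]_n :=
  xget 0 [set S : 'M[R]_n | possemidef S /\ S *m S = M].

Definition lambda_min (R : realType) n (M : 'M[R]_n) : R :=
  inf [set a : R | eigenvalue M a].

(* Used for matrices with a positive diagonal, where starting the maximum
   at 0 is harmless. *)
Definition max_diag (R : realType) n (M : 'M[R]_n) : R :=
  \big[Num.max/0]_(i < n) M i i.

Definition min_diag (R : realType) n (M : 'M[R]_n) : R :=
  inf [set M i i | i in [set: 'I_n]].

Definition row_sparsity (R : realType) n (M : 'M[R]_n) : nat :=
  \max_(i < n) #|[set j : 'I_n | M i j != 0%R]%SET|.

Definition hadamard (R : realType) m n (M N : 'M[R]_(m, n)) : 'M[R]_(m, n) :=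
  \matrix_(i, j) (M i j * N i j).

(* [x / 0 = 0] in MathComp, in agreement with the convention 0/0 = 0. *)
Definition hdiv (R : realType) m n (M N : 'M[R]_(m, n)) : 'M[R]_(m, n) :=
  \matrix_(i, j) (M i j / N i j).

(** [a] and [b] are of the same order, with constants [c] and [C]. *)
Definition asymp (R : realType) (c C a b : R) : Prop := c * a <= b <= C * a.

Definition cond_number (R : realType) n (B : 'M[R]_n) : R :=
  opnorm2 B / lambda_min B.

Definition eta_A (R : realType) m (A : 'M[R]_m) : R :=
  Num.sqrt (max_diag A / min_diag A).

(* A zero denominator would make this 0 instead of infinite; the condition
   0 < lambda <= C * ... * r_offd of the theorem excludes that case. *)
Definition r_offd (R : realType) n m (A : 'M[R]_m) (p : 'I_m -> R) : R :=
  eta_A A * Num.sqrt (opnorm2 A * ln ((maxn m n)%:R) /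
                      \sum_(j < m) A j j * p j ^+ 2).

Definition sdmx (R : realType) n (B : 'M[R]_n) : 'M[R]_n :=
  diag_mx (\row_i Num.sqrt (B i i)).

Definition corrmx (R : realType) n (B : 'M[R]_n) : 'M[R]_n :=
  invmx (sdmx B) *m B *m invmx (sdmx B).

Definition kappa_rho (R : realType) n (B : 'M[R]_n) : R :=
  opnorm2 (corrmx B) * opnorm2 (invmx (corrmx B)).

(* "Bounded positive entries" of W: they lie in a fixed compact interval
   [wlo, whi], where the theorem takes 0 < wlo. *)
Definition assumption_A1 (R : realType) n (wlo whi Mrho MOmega : R)
    (B : 'M[R]_n) : Prop :=
  [/\ forall i, wlo <= sdmx B i i <= whi,
      1 <= opnorm2 (corrmx B) <= Mrho &
      1 <= opnorm2 (invmx (corrmx B)) <= MOmega].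

(** Observed data: the mask takes values in {0, 1}, i.e. in [bool]. *)

Definition maskmx (R : realType) n m (U : 'M[bool]_(n, m)) : 'M[R]_(n, m) :=
  \matrix_(i, j) (U i j)%:R.

Definition observed (R : realType) n m (A : 'M[R]_m) (B : 'M[R]_n)
    (U : 'M[bool]_(n, m)) (Z : 'M[R]_(n, m)) : 'M[R]_(n, m) :=
  hadamard (maskmx R U) (sqrtmx B *m Z *m sqrtmx A).

Definition phat (R : realType) n m (U : 'M[bool]_(n, m)) (j : 'I_m) : R :=
  n%:R^-1 * \sum_(k < n) maskmx R U k j.

Definition Mhat (R : realType) n m (U : 'M[bool]_(n, m)) : 'M[R]_m :=
  \matrix_(i, j) (if i == j then phat R U i else phat R U i * phat R U j).

Definition bbMhat (R : realType) n m (U : 'M[bool]_(n, m))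
    (X : 'M[R]_(n, m)) : 'M[R]_n :=
  \matrix_(i, j)
    if i == j then n%:R^-1 * \tr (X^T *m X)
    else (n%:R - 1)^-1 * \tr (hadamard (X^T *m X) (Mhat R U))
         - (n%:R * (n%:R - 1))^-1 * \tr (X^T *m X).

Definition Bstar (R : realType) n m (U : 'M[bool]_(n, m))
    (X : 'M[R]_(n, m)) : 'M[R]_n :=
  hdiv (X *m X^T) (bbMhat U X).

(** Nodewise regressions.  Coordinate [k : 'I_n.-1] of a vector indexed by
    [n] minus [j] stands for the index [lift j k]. *)

Definition Gammahat (R : realType) n (B : 'M[R]_n) (j : 'I_n) :
    'M[R]_(n.-1) :=
  row' j (col' j B).

Definition gammahat (R : realType) n (B : 'M[R]_n) (j : 'I_n) :
    'cV[R]_(n.-1) :=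
  row' j (col j B).

Definition beta_star (R : realType) n (Theta : 'M[R]_n) (j : 'I_n) :
    'cV[R]_(n.-1) :=
  \col_k (- Theta j (lift j k) / Theta j j).

Definition lower_RE (R : realType) n (alpha tau : R) (G : 'M[R]_n) : Prop :=
  forall v : 'cV[R]_n,
    alpha * vnorm2 v ^+ 2 - tau * vnorm1 v ^+ 2 <= qform G v.

Definition lasso_objective (R : realType) n (G : 'M[R]_n) (g : 'cV[R]_n)
    (lambda : R) (b : 'cV[R]_n) : R :=
  2^-1 * qform G b - dotp g b + lambda * vnorm1 b.

Definition lasso_argmin (R : realType) n (G : 'M[R]_n) (g : 'cV[R]_n)
    (lambda b1 : R) (b : 'cV[R]_n) : Prop :=
  vnorm1 b <= b1 /\
  forall b' : 'cV[R]_n, vnorm1 b' <= b1 ->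
    lasso_objective G g lambda b <= lasso_objective G g lambda b'.

Definition Theta_tilde_diag (R : realType) n (B : 'M[R]_n)
    (bhat : 'I_n -> 'cV[R]_(n.-1)) (j : 'I_n) : R :=
  (B j j - \sum_k B j (lift j k) * bhat j k 0)^-1.

Definition Theta_tilde (R : realType) n (B : 'M[R]_n)
    (bhat : 'I_n -> 'cV[R]_(n.-1)) : 'M[R]_n :=
  \matrix_(j, i) if unlift j i is Some k
                 then - Theta_tilde_diag B bhat j * bhat j k 0
                 else Theta_tilde_diag B bhat j.

Definition symm_proj (R : realType) n (T That : 'M[R]_n) : Prop :=
  symmx That /\
  forall S : 'M[R]_n, symmx S -> mxnorm_oo (That - T) <= mxnorm_oo (S - T).

(* [That] is one of the possible outputs of the construction: the minimizers
   in its first and last steps need not be unique. *)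
Definition is_Theta_hat (R : realType) n (B : 'M[R]_n) (lambda b1 : R)
    (That : 'M[R]_n) : Prop :=
  exists bhat : 'I_n -> 'cV[R]_(n.-1),
    (forall j, lasso_argmin (Gammahat B j) (gammahat B j) lambda b1 (bhat j))
    /\ symm_proj (Theta_tilde B bhat) That.

(* Main.v *)
Require Import Defs.
From mathcomp Require Import ring lra.

Set Implicit Arguments.
Unset Strict Implicit.
Unset Printing Implicit Defensive.

Local Open Scope classical_set_scope.
Local Open Scope ring_scope.

(** Write [v] for the lasso error in node [j].  The basic inequality and the
    lower-RE condition give [|v|_2 <= 3 lambda sqrt(d0) / alpha] and
    [|v|_1 <= 12 lambda d0 / alpha].  With the full vectors [u = (1, - beta_star)]
    and [w = (1, - bhat)], row [j] of [Theta0] is [u / (B0 u)_j] and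
    row [j] of the estimate is [w / (Bstar w)_j], so everything reduces to
    comparing the two normalizations.  Their difference is bounded through
    [|(Bstar - B0) u| <= delta |u|_1], with
    [theta_jj |u|_1 <= sqrt(d0) |Theta0 e_j|_2], and through
    [|B0 v| <= |B0|_2 |v|_2]; the l2 bound is essential here, since only
    [r sqrt(d0)], and not [r d0], is small. *)

(** * Inner products, Euclidean norms and operator norms *)

Section InnerProduct.
Context {R : realType}.
Implicit Types (m n : nat).

Lemma dotpE n (u v : 'cV[R]_n) : dotp u v = (u^T *m v) 0 0.
Proof. by rewrite !mxE; apply: eq_bigr => i _; rewrite mxE. Qed.

Lemma dotpC n (u v : 'cV[R]_n) : dotp u v = dotp v u.
Proof. by apply: eq_bigr => i _; rewrite mulrC. Qed.

Lemma dotpDl n (u v w : 'cV[R]_n) : dotp (u + v) w = dotp u w + dotp v w.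
Proof. by rewrite !dotpE linearD /= mulmxDl mxE. Qed.

Lemma dotpZl n a (u v : 'cV[R]_n) : dotp (a *: u) v = a * dotp u v.
Proof. by rewrite !dotpE linearZ /= -scalemxAl mxE. Qed.

Lemma dotpDr n (u v w : 'cV[R]_n) : dotp u (v + w) = dotp u v + dotp u w.
Proof. by rewrite !(dotpC u) dotpDl. Qed.

Lemma dotpZr n a (u v : 'cV[R]_n) : dotp u (a *: v) = a * dotp u v.
Proof. by rewrite !(dotpC u) dotpZl. Qed.

Lemma dotpBr n (u v w : 'cV[R]_n) : dotp u (v - w) = dotp u v - dotp u w.
Proof. by rewrite -scaleN1r dotpDr dotpZr mulN1r. Qed.

Lemma dotp_mulmx m n (M : 'M[R]_(m, n)) u v :
  dotp u (M *m v) = dotp (M^T *m u) v.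
Proof. by rewrite !dotpE trmx_mul trmxK mulmxA. Qed.

Lemma dotp_symmx n (M : 'M[R]_n) u v :
  symmx M -> dotp u (M *m v) = dotp v (M *m u).
Proof. by move=> MT; rewrite dotp_mulmx MT dotpC. Qed.

Lemma qformD n (M : 'M[R]_n) u v : symmx M ->
  qform M (u + v) = qform M u + 2 * dotp v (M *m u) + qform M v.
Proof.
move=> MT; rewrite /qform mulmxDr dotpDl !dotpDr (dotp_symmx _ _ MT).
by ring.
Qed.

Lemma sqr_vnorm2 n (v : 'cV[R]_n) : vnorm2 v ^+ 2 = dotp v v.
Proof.
rewrite sqr_sqrtr; last by apply: sumr_ge0 => i _; rewrite sqr_ge0.
by apply: eq_bigr => i _; rewrite expr2.
Qed.

Lemma vnorm2_ge0 n (v : 'cV[R]_n) : 0 <= vnorm2 v.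
Proof. exact: sqrtr_ge0. Qed.

Lemma vnorm2Z n a (v : 'cV[R]_n) : vnorm2 (a *: v) = `|a| * vnorm2 v.
Proof.
apply/(pexpIrn (ltn0Sn 1)); rewrite ?nnegrE ?mulr_ge0 ?vnorm2_ge0//.
rewrite sqr_vnorm2 exprMn sqr_vnorm2 dotpZl dotpZr real_normK ?num_real//.
by rewrite mulrA expr2.
Qed.

Lemma ler_vnorm2 n (v : 'cV[R]_n) i : `|v i 0| <= vnorm2 v.
Proof.
rewrite -sqrtr_sqr ler_wsqrtr // (bigD1 i) //= lerDl.
by apply: sumr_ge0 => k _; rewrite sqr_ge0.
Qed.

Lemma vnorm2_eq0 n (v : 'cV[R]_n) : vnorm2 v = 0 -> v = 0.
Proof.
move=> v0; apply/matrixP => i j; rewrite ord1 mxE.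
by apply/eqP; rewrite -normr_le0 -v0 ler_vnorm2.
Qed.

Lemma vnorm2_delta n (i : 'I_n) : vnorm2 (delta_mx i 0) = 1 :> R.
Proof.
rewrite /vnorm2 (bigD1 i) //= big1 => [|k ki]; rewrite mxE ?eqxx.
  by rewrite addr0 expr1n sqrtr1.
by rewrite (negPf ki) expr0n.
Qed.

Lemma vnorm2_le n (u v : 'cV[R]_n) :
  (forall i, `|u i 0| <= `|v i 0|) -> vnorm2 u <= vnorm2 v.
Proof.
move=> uv; rewrite ler_wsqrtr//; apply: ler_sum => i _.
rewrite -[leLHS]real_normK ?num_real// -[leRHS]real_normK ?num_real//.
by rewrite lerXn2r ?nnegrE.
Qed.

Lemma cauchy_schwarz n (u v : 'cV[R]_n) : `|dotp u v| <= vnorm2 u * vnorm2 v.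
Proof.
have [v0|v0] := eqVneq (vnorm2 v) 0.
  rewrite v0 (vnorm2_eq0 v0) mulr0 /dotp big1 ?normr0// => i _.
  by rewrite mxE mulr0.
have v_gt0 : 0 < vnorm2 v by rewrite lt_def v0 vnorm2_ge0.
rewrite -(ler_pXn2r (ltn0Sn 1)) ?nnegrE ?mulr_ge0 ?vnorm2_ge0//.
rewrite exprMn real_normK ?num_real//.
(* [a *: v] is the orthogonal projection of [u] on [v]; the claim is [0 <= |u - a v|^2]. *)
set a := dotp u v / vnorm2 v ^+ 2.
have dE : dotp u v = a * vnorm2 v ^+ 2 by rewrite divfK// expf_neq0.
have := sqr_ge0 (vnorm2 (u - a *: v)).
rewrite sqr_vnorm2 dotpBr dotpZr ![dotp (_ - _) _]dotpC !dotpBr !dotpZr.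
rewrite [dotp v u]dotpC dE -!sqr_vnorm2.
by move: (vnorm2 u) (vnorm2 v) => x y h; nra.
Qed.

Lemma dotp_norm1_le n (u v : 'cV[R]_n) c :
  (forall i, `|u i 0| <= c) -> `|dotp u v| <= c * vnorm1 v.
Proof.
move=> uc; apply: le_trans (ler_norm_sum _ _ _) _.
rewrite mulr_sumr; apply: ler_sum => i _.
by rewrite normrM ler_wpM2r.
Qed.

Lemma mx_norm_ge m n (M : 'M[R]_(m, n)) i j : `|M i j| <= `|M|.
Proof.
by rewrite [leRHS]mx_normrE (le_bigmax 0 (fun ij => `|M ij.1 ij.2|) (i, j)).
Qed.

(** Cauchy-Schwarz against the indicator of [S]. It serves both for the lasso error on the support
    and for the l1 norm of a sparse row of the precision matrix. *)
Lemma sum_norm_le_card n (S : {set 'I_n}) (v : 'cV[R]_n) d :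
  (#|S| <= d)%N ->
  \sum_(i in S) `|v i 0| <= Num.sqrt d%:R * vnorm2 v.
Proof.
move=> Sd.
pose u : 'cV[R]_n := \col_i (i \in S)%:R.
pose w : 'cV[R]_n := \col_i `|v i 0|.
have -> : \sum_(i in S) `|v i 0| = dotp u w.
  rewrite big_mkcond; apply: eq_bigr => i _; rewrite !mxE.
  by case: (i \in S); rewrite (mul1r, mul0r).
apply: le_trans (ler_norm _) (le_trans (cauchy_schwarz _ _) _).
rewrite ler_pM ?vnorm2_ge0//; last by apply: vnorm2_le => i; rewrite mxE normr_id.
rewrite ler_wsqrtr//.
under eq_bigr do rewrite mxE -natrX.
rewrite -natr_sum ler_nat; apply: leq_trans Sd.
by rewrite -sum1_card [leqRHS]big_mkcond leq_sum// => i _; case: (i \in S).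
Qed.

Lemma vnorm2_0 n : vnorm2 (0 : 'cV[R]_n) = 0.
Proof. by rewrite -(scale0r 0) vnorm2Z normr0 mul0r. Qed.

Lemma opnorm2_ge m n (M : 'M[R]_(m, n)) v :
  vnorm2 v <= 1 -> vnorm2 (M *m v) <= opnorm2 M.
Proof.
move=> v1; apply: ub_le_sup; last by exists v.
(* The supremum needs an upper bound: the entries of [w] are at most 1 in absolute value, so
   absolute row sums dominate the entries of [M *m w]. *)
exists (Num.sqrt (\sum_i (\sum_j `|M i j|) ^+ 2)) => _ [w /= w1 <-].
rewrite ler_wsqrtr//; apply: ler_sum => i _.
rewrite -[leLHS]real_normK ?num_real// lerXn2r ?nnegrE ?sumr_ge0//.
rewrite mxE; apply: le_trans (ler_norm_sum _ _ _) _.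
apply: ler_sum => j _; rewrite normrM ler_piMr//.
by apply: le_trans w1; exact: ler_vnorm2.
Qed.

Lemma opnorm2_ge0 m n (M : 'M[R]_(m, n)) : 0 <= opnorm2 M.
Proof.
by rewrite -(vnorm2_0 m) -(mulmx0 _ M) opnorm2_ge// vnorm2_0.
Qed.

Lemma opnorm2_ub m n (M : 'M[R]_(m, n)) v :
  vnorm2 (M *m v) <= opnorm2 M * vnorm2 v.
Proof.
have [v0|v0] := eqVneq (vnorm2 v) 0.
  by rewrite v0 (vnorm2_eq0 v0) mulmx0 vnorm2_0 mulr0.
have v_gt0 : 0 < vnorm2 v by rewrite lt_def v0 vnorm2_ge0.
rewrite -ler_pdivrMr//.
have -> : vnorm2 (M *m v) / vnorm2 v = vnorm2 (M *m ((vnorm2 v)^-1 *: v)).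
  by rewrite -scalemxAr vnorm2Z gtr0_norm ?invr_gt0// mulrC.
by rewrite opnorm2_ge// vnorm2Z gtr0_norm ?invr_gt0// mulVf.
Qed.

Lemma opnorm2_le m n (M : 'M[R]_(m, n)) c : 0 <= c ->
  (forall v, vnorm2 (M *m v) <= c * vnorm2 v) -> opnorm2 M <= c.
Proof.
move=> c0 Mc; apply: ge_sup.
  by exists (vnorm2 (M *m 0)); exists 0; rewrite //= vnorm2_0.
move=> _ [v /= v1 <-]; apply: le_trans (Mc v) _.
by rewrite ler_piMr.
Qed.

Lemma opnorm2M m n q (M : 'M[R]_(m, n)) (N : 'M[R]_(n, q)) :
  opnorm2 (M *m N) <= opnorm2 M * opnorm2 N.
Proof.
apply: opnorm2_le => [|v]; first by rewrite mulr_ge0 ?opnorm2_ge0.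
rewrite -mulmxA -mulrA; apply: le_trans (opnorm2_ub _ _) _.
by rewrite ler_wpM2l ?opnorm2_ge0// opnorm2_ub.
Qed.

Lemma opnorm2_diag n (D : 'rV[R]_n) c : 0 <= c ->
  (forall i, `|D 0 i| <= c) -> opnorm2 (diag_mx D) <= c.
Proof.
move=> c0 Dc; apply: opnorm2_le => // v.
rewrite -(ger0_norm c0) -vnorm2Z; apply: vnorm2_le => i.
by rewrite mul_diag_mx !mxE !normrM ler_wpM2r// (ger0_norm c0).
Qed.

End InnerProduct.

(** * Lasso error under a lower-RE condition *)

Section Lasso.
Context {R : realType} (n : nat).
Implicit Types (G : 'M[R]_n) (g b v : 'cV[R]_n).

Lemma vnorm1_ge0 v : 0 <= vnorm1 v.
Proof. exact: sumr_ge0. Qed.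

Lemma ler_vnorm1B v b : vnorm1 (v - b) <= vnorm1 v + vnorm1 b.
Proof. by rewrite -big_split ler_sum// => i _; rewrite !mxE ler_normB. Qed.

Lemma ler_vnorm1D v b : vnorm1 (v + b) <= vnorm1 v + vnorm1 b.
Proof. by rewrite -big_split ler_sum// => i _; rewrite !mxE ler_normD. Qed.

Lemma vnorm1_split v (S : {set 'I_n}) :
  vnorm1 v = \sum_(i in S) `|v i 0| + \sum_(i | i \notin S) `|v i 0|.
Proof. exact: bigID. Qed.

(** Comparing the objective at [bh] with its value at the feasible point [bs] bounds the form at
    [v = bh - bs] from above; lower-RE bounds it from below, and the radius [b1] controls the
    tolerance term. *)
Lemma lasso_error G g (lambda b1 alpha tau : R) bs bh (S : {set 'I_n}) d :
  symmx G -> 0 < lambda -> 0 < alpha -> 0 <= tau -> 4 * b1 * tau <= lambda ->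
  lower_RE alpha tau G -> `|g - G *m bs| <= lambda / 4 ->
  (forall i, i \notin S -> bs i 0 = 0) -> (#|S| <= d)%N ->
  vnorm1 bs <= b1 -> lasso_argmin G g lambda b1 bh ->
  alpha * vnorm2 (bh - bs) <= 3 * lambda * Num.sqrt d%:R /\
  alpha * vnorm1 (bh - bs) <= 12 * lambda * d%:R.
Proof.
move=> GT l0 a0 t0 tb1 RE gG bsS Sd bs1 [bh1 /(_ _ bs1) opt].
set v := bh - bs; have bhE : bh = bs + v by rewrite /v addrC subrK.
set P := \sum_(i in S) `|v i 0|; set Q := \sum_(i | i \notin S) `|v i 0|.
have v1E : vnorm1 v = P + Q by exact: vnorm1_split.
have P0 : 0 <= P by exact: sumr_ge0.
have Q0 : 0 <= Q by exact: sumr_ge0.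
(* Off [S], [bs] vanishes and [bh] equals the error, which contributes [- Q]; on [S] the triangle
   inequality loses at most [P]. *)
have l1 : vnorm1 bs - vnorm1 bh <= P - Q.
  rewrite (vnorm1_split _ S) [\sum_(i | i \notin S) _]big1 => [|i iS]; last first.
    by rewrite bsS// normr0.
  have -> : Q = \sum_(i | i \notin S) `|bh i 0|.
    by apply: eq_bigr => i iS; rewrite bhE [in RHS]mxE bsS// add0r.
  rewrite (vnorm1_split _ S) addr0 opprD addrA lerD2r lerBlDr -big_split /=.
  apply: ler_sum => i _; rewrite bhE [(bs + v) i 0]mxE addrC.
  by have := ler_normB (bs i 0 + v i 0) (v i 0); rewrite addrK.
have gv : dotp (g - G *m bs) v <= lambda / 4 * vnorm1 v.
  apply: le_trans (ler_norm _) _; apply: dotp_norm1_le => i.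
  exact: le_trans (mx_norm_ge _ _ _) gG.
have v2b : vnorm1 v <= 2 * b1 by have := ler_vnorm1B bh bs; lra.
have := RE v; move: opt; rewrite /lasso_objective [in qform G bh]bhE qformD//.
rewrite [in dotp g bh]bhE dotpDr.
have -> : dotp v (G *m bs) = dotp g v - dotp (g - G *m bs) v.
  by rewrite [dotp (_ - _) v]dotpC (dotpBr v g) (dotpC v g); ring.
set V := vnorm2 v; have V0 : 0 <= V by exact: vnorm2_ge0.
have PV : P <= Num.sqrt d%:R * V by exact: sum_norm_le_card.
have sd : Num.sqrt d%:R ^+ 2 = d%:R :> R by rewrite sqr_sqrtr.
have := sqrtr_ge0 (d%:R : R).
move: (Num.sqrt _) sd PV => s sd PV s0 opt REv.
(* As [bs] and [bh] both lie in the l1 ball of radius [b1], one factor [|v|_1] is at most [2 b1];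
   the quadratic tolerance term becomes linear. *)
have tvv : tau * vnorm1 v ^+ 2 <= lambda / 2 * vnorm1 v.
  have v0 := vnorm1_ge0 v.
  have : tau * vnorm1 v <= tau * (2 * b1) by rewrite ler_wpM2l.
  by move=> h; rewrite expr2 mulrA ler_wpM2r//; lra.
(* [alpha V^2 <= lambda/2 (P + Q) + 2 (lambda/4 (P + Q) + lambda (P - Q))], from tolerance, noise
   and penalty in turn. *)
have key : alpha * V ^+ 2 <= lambda * (3 * P - Q).
  have : lambda * (vnorm1 bs - vnorm1 bh) <= lambda * (P - Q).
    by rewrite ler_pM2l.
  by move: gv tvv opt REv; rewrite v1E; lra.
have aV : alpha * V <= 3 * lambda * s.
  have [->|Vn0] := eqVneq V 0; first by rewrite mulr0; apply: mulr_ge0 => //; lra.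
  have Vp : 0 < V by rewrite lt_def Vn0.
  rewrite -(ler_pM2r Vp) [leLHS](_ : _ = alpha * V ^+ 2); last by ring.
  apply: le_trans key _.
  have : lambda * P <= lambda * (s * V) by rewrite ler_pM2l.
  have : 0 <= lambda * Q by rewrite mulr_ge0// ltW.
  by lra.
split => //; rewrite v1E.
(* The cone condition, read off from the sign of the left side of [key]; hence
   [P + Q <= 4 P <= 4 s V]. *)
have QP : Q <= 3 * P.
  have : 0 <= lambda * (3 * P - Q).
    by apply: le_trans key; rewrite mulr_ge0 ?sqr_ge0// ltW.
  by rewrite pmulr_rge0//; lra.
have : alpha * (P + Q) <= alpha * (4 * (s * V)) by rewrite ler_pM2l//; lra.
have : s * (alpha * V) <= s * (3 * lambda * s) by rewrite ler_wpM2l.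
by rewrite -sd; lra.
Qed.

End Lasso.

(** * Rows of the precision matrix as normalized regression vectors *)

Section Precision.
Context {R : realType} (n : nat).
Implicit Types (B Theta : 'M[R]_n) (j : 'I_n).

(** By symmetry, the form vanishes at the transpose of any row of the left kernel, so that row is
    0. *)
Lemma posdef_unitmx B : posdef B -> B \in unitmx.
Proof.
move=> [BT Bp]; rewrite -row_free_unit -kermx_eq0; apply/eqP/row_matrixP => i.
rewrite row0; set x := row i _.
have xB : x *m B = 0 by rewrite -row_mul mulmx_ker row0.
apply/eqP/negPn/negP => x0.
have /Bp : x^T != 0 by apply: contraNneq x0 => h; rewrite -(trmxK x) h trmx0.
by rewrite /qform -BT -trmx_mul xB trmx0 dotpC dotpE trmx0 mul0mx mxE ltxx.
Qed.

Lemma symmx_inv B : symmx B -> symmx (invmx B).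
Proof. by rewrite /symmx trmx_inv => ->. Qed.

Lemma posdef_inv B : posdef B -> posdef (invmx B).
Proof.
move=> Bp; have Bu := posdef_unitmx Bp; case: Bp => BT Bp.
split=> [|v v0]; first exact: symmx_inv.
have -> : qform (invmx B) v = qform B (invmx B *m v).
  by rewrite /qform mulKVmx// dotpC.
by apply: Bp; apply: contraNneq v0 => h; rewrite -(mulKVmx Bu v) h mulmx0.
Qed.

Lemma qform_delta B j : qform B (delta_mx j 0) = B j j.
Proof. by rewrite /qform dotpE -colE trmx_delta -rowE !mxE. Qed.

Lemma delta_cV_neq0 j : delta_mx j 0 != 0 :> 'cV[R]_n.
Proof.
by apply/eqP => /matrixP/(_ j 0)/eqP; rewrite !mxE !eqxx oner_eq0.
Qed.

Lemma posdef_diag_gt0 B j : posdef B -> 0 < B j j.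
Proof. by move=> [_ Bp]; rewrite -qform_delta Bp// delta_cV_neq0. Qed.

Lemma vnorm2_col_le B j : vnorm2 (col j B) <= opnorm2 B.
Proof.
by rewrite colE; have := opnorm2_ub B (delta_mx j 0); rewrite vnorm2_delta mulr1.
Qed.

Lemma diag_le_opnorm2 B j : B j j <= opnorm2 B.
Proof.
apply: le_trans (vnorm2_col_le B j); apply: le_trans (ler_norm _) _.
by have := ler_vnorm2 (col j B) j; rewrite mxE.
Qed.

(* Expand the nonnegative form at [v - s B v], with [s = 1 / |B|_2]. *)
Lemma sqr_vnorm2_mulmx_le B v :
  posdef B -> vnorm2 (B *m v) ^+ 2 <= opnorm2 B * qform B v.
Proof.
move=> [BT Bp].
have [Nle|Np] := leP (opnorm2 B) 0.
  have -> : vnorm2 (B *m v) = 0.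
    apply/eqP; rewrite eq_le vnorm2_ge0 andbT; apply: le_trans (opnorm2_ub _ _) _.
    by rewrite mulr_le0_ge0// vnorm2_ge0.
  rewrite expr0n /= mulr_ge0 ?opnorm2_ge0//.
  by have [->|/Bp/ltW//] := eqVneq v 0; rewrite /qform mulmx0 dotpE mulmx0 mxE.
set N := opnorm2 B in Np *; set y := B *m v.
have : 0 <= qform B (v + (- N^-1) *: y).
  set z := v + _; have [->|/Bp/ltW//] := eqVneq z 0.
  by rewrite /qform mulmx0 dotpE mulmx0 mxE.
rewrite qformD// dotpZl -/y -sqr_vnorm2.
have -> : qform B (- N^-1 *: y) = N^-1 ^+ 2 * dotp y (B *m y).
  by rewrite /qform -scalemxAr dotpZl dotpZr mulrA mulNr mulrN opprK expr2.
have : dotp y (B *m y) <= N * vnorm2 y ^+ 2.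
  apply: le_trans (ler_norm _) (le_trans (cauchy_schwarz _ _) _).
  by rewrite expr2 mulrA mulrC ler_wpM2r ?vnorm2_ge0// opnorm2_ub.
move=> h1 h2.
have h3 : N^-1 ^+ 2 * dotp y (B *m y) <= N^-1 * vnorm2 y ^+ 2.
  rewrite expr2 -mulrA ler_pM2l ?invr_gt0//.
  by rewrite ler_pdivrMl.
have : 0 <= qform B v - N^-1 * vnorm2 y ^+ 2 by lra.
by rewrite subr_ge0 ler_pdivrMl.
Qed.

(** The full vector [(1, - b)], with the 1 in position [j], on which an [n]-by-[n] matrix can
    act. *)
Definition regress_col j (b : 'cV[R]_n.-1) : 'cV[R]_n :=
  \col_i (if unlift j i is Some k then - b k 0 else 1).

Lemma sum_lift (F : 'I_n -> R) j :
  \sum_i F i = F j + \sum_(k < n.-1) F (lift j k).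
Proof. by rewrite (bigD1_ord j). Qed.

Lemma regress_colB j (b c : 'cV[R]_n.-1) :
  let w := regress_col j c - regress_col j b in
  vnorm1 w = vnorm1 (c - b) /\ vnorm2 w = vnorm2 (c - b).
Proof.
rewrite /vnorm1 /vnorm2 !(sum_lift _ j) !mxE unlift_none subrr.
rewrite normr0 expr0n /= !add0r; split.
  by apply: eq_bigr => k _; rewrite !mxE liftK opprK addrC distrC.
congr (Num.sqrt _); apply: eq_bigr => k _; rewrite !mxE liftK.
by rewrite opprK addrC -sqrrN opprB.
Qed.

(** Turns the denominator of [Theta_tilde_diag] into a coordinate of a matrix-vector product, which
    can be split along [w = u + v]. *)
Lemma mulmx_regress_col B j b :
  (B *m regress_col j b) j 0 = B j j - \sum_k B j (lift j k) * b k 0.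
Proof.
rewrite mxE (sum_lift _ j) !mxE unlift_none mulr1 -sumrN; congr (_ + _).
by apply: eq_bigr => k _; rewrite !mxE liftK mulrN.
Qed.

Lemma regress_col_beta_star Theta j : Theta j j != 0 ->
  regress_col j (beta_star Theta j) = (Theta j j)^-1 *: (row j Theta)^T.
Proof.
move=> t0; apply/matrixP => i o; rewrite !mxE.
case: unliftP => [k ->|->]; last by rewrite mulVf.
by rewrite mxE mulNr opprK mulrC.
Qed.

Lemma Theta_tildeE B bh j i :
  Theta_tilde B bh j i =
    ((B *m regress_col j (bh j)) j 0)^-1 * regress_col j (bh j) i 0.
Proof.
rewrite mulmx_regress_col !mxE /Theta_tilde_diag; case: unlift => [k|].
  by rewrite mulrN mulNr.
by rewrite mulr1.
Qed.

(** With [a = (Bs w)_j] and [t = Theta_jj], the estimated row is [w / a] and the true one [t u], so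
    the error is [(1/a - t) u + v / a]. The smallness hypothesis gives [t |a - 1/t| <= 1/2], hence
    [1/a <= 2 t]. [X] stands for [3 lambda / alpha]. *)
Lemma Theta_tilde_row_error B Bs bh j (d : nat) (delta X : R) :
  let Theta := invmx B in
  let s := Num.sqrt d%:R : R in
  posdef B -> (#|[set i | Theta j i != 0%R]%SET| <= d)%N ->
  `|Bs - B| <= delta -> 0 <= X ->
  vnorm2 (bh j - beta_star Theta j) <= X * s ->
  vnorm1 (bh j - beta_star Theta j) <= 4 * X * d%:R ->
  delta * s * opnorm2 Theta + opnorm2 B * X * s * Theta j j
    + 4 * delta * X * d%:R * Theta j j <= 2^-1 ->
  \sum_i `|Theta_tilde Bs bh j i - Theta j i| <=
    2 * delta * d%:R * opnorm2 Theta * Theta j j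
    + 2 * opnorm2 B * X * d%:R * opnorm2 Theta * Theta j j
    + 8 * delta * X * s * d%:R * opnorm2 Theta * Theta j j
    + 8 * X * d%:R * Theta j j.
Proof.
move=> Theta s Bp dj BsB X0.
have Tp : posdef Theta := posdef_inv Bp.
have t0 : 0 < Theta j j := posdef_diag_gt0 j Tp.
set u := regress_col j (beta_star Theta j); set w := regress_col j (bh j).
have [<- <-] := regress_colB j (beta_star Theta j) (bh j); rewrite -/u -/w.
set v := w - u => v2 v1 small.
have wE : w = u + v by rewrite /v addrC subrK.
have rowE : (row j Theta)^T = col j Theta.
  by case: Tp => TT _; rewrite tr_row TT.
have uE : u = (Theta j j)^-1 *: col j Theta.
  by rewrite /u regress_col_beta_star ?gt_eqF// rowE.
set t := Theta j j in t0 small uE *; set T := opnorm2 Theta in small *.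
set N := opnorm2 B in small *; set q := vnorm2 (col j Theta).
have N0 : 0 <= N := opnorm2_ge0 B.
have T0 : 0 <= T := opnorm2_ge0 Theta.
have s0 : 0 <= s := sqrtr_ge0 _.
have sd : s ^+ 2 = d%:R by rewrite sqr_sqrtr.
have q0 : 0 <= q := vnorm2_ge0 _.
have qT : q <= T by exact: vnorm2_col_le.
(* Sharper than [q <= T] when [t] is small: it retains a factor [t] where squaring [q <= T] would
   give [T^2]. *)
have qqT : q ^+ 2 <= T * t.
  by rewrite /q colE /t -qform_delta sqr_vnorm2_mulmx_le.
have delta0 : 0 <= delta by apply: le_trans BsB.
(* [t u] is column [j] of the symmetric [Theta], with at most [d] nonzero entries. *)
have u1 : t * vnorm1 u <= s * q.
  have -> : t * vnorm1 u =
      \sum_(i in [set i | Theta j i != 0%R]%SET) `|col j Theta i 0|.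
    rewrite mulr_sumr [RHS]big_mkcond; apply: eq_bigr => i _.
    rewrite uE -rowE !mxE inE normrM normfV (gtr0_norm t0) (mulVKf (lt0r_neq0 t0)).
    by have [->|_] := eqVneq (Theta j i) 0; rewrite ?normr0.
  exact: sum_norm_le_card.
(* [B] maps column [j] of its inverse to the [j]th basis vector. *)
have Bu : (B *m u) j 0 = t^-1.
  by rewrite uE -scalemxAr colE mulmxA mulmxV ?posdef_unitmx// mul1mx !mxE !eqxx mulr1.
pose a := (Bs *m w) j 0.
have aE : a - t^-1 = ((Bs - B) *m u) j 0 + (B *m v) j 0 + ((Bs - B) *m v) j 0.
  rewrite -Bu /a wE mulmxDr !mulmxBl !mxE.
  by rewrite !(addrA, opprD); ring.
have Dle x : `|((Bs - B) *m x) j 0| <= delta * vnorm1 x.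
  have -> : ((Bs - B) *m x) j 0 = dotp (row j (Bs - B))^T x.
    by rewrite mxE; apply: eq_bigr => i _; rewrite !mxE.
  apply: dotp_norm1_le => i; apply: le_trans BsB.
  by rewrite 2!mxE mx_norm_ge.
set E := `|a - t^-1|.
(* The terms with [Bs - B] pair the entrywise bound with l1 norms; the middle one goes through the
   operator norm and costs only [s], not [d]. *)
have Ele : E <= delta * vnorm1 u + N * vnorm2 v + delta * vnorm1 v.
  rewrite /E aE; apply: le_trans (ler_normD _ _) _; rewrite lerD ?Dle//.
  apply: le_trans (ler_normD _ _) _; rewrite lerD ?Dle//.
  exact: le_trans (ler_vnorm2 _ _) (opnorm2_ub _ _).
have tEle : t * E <= delta * s * q + N * X * s * t + 4 * delta * X * d%:R * t.
  have h1 : t * E <= t * (delta * vnorm1 u + N * vnorm2 v + delta * vnorm1 v).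
    by rewrite ler_pM2l.
  have h2 : delta * (t * vnorm1 u) <= delta * (s * q) by rewrite ler_wpM2l.
  have h3 : t * (N * vnorm2 v) <= t * (N * (X * s)) by rewrite ler_pM2l// ler_wpM2l.
  have h4 : t * (delta * vnorm1 v) <= t * (delta * (4 * X * d%:R)).
    by rewrite ler_pM2l// ler_wpM2l.
  by lra.
have tE2 : t * E <= 2^-1.
  apply: le_trans tEle (le_trans _ small); rewrite !lerD2r.
  by rewrite ler_wpM2l// mulr_ge0.
have a_ge : 2^-1 <= t * a.
  have : `|t * a - 1| <= 2^-1.
    by rewrite -[X in _ - X](mulfV (lt0r_neq0 t0)) -mulrBr normrM (gtr0_norm t0).
  by rewrite ler_norml => /andP[]; lra.
have a0 : 0 < a by rewrite -(pmulr_rgt0 _ t0); lra.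
have ai : a^-1 <= 2 * t.
  by rewrite -(ler_pM2r a0) mulVf ?gt_eqF//; lra.
have ait : `|a^-1 - t| <= 2 * t * (t * E).
  have -> : a^-1 - t = - (a^-1 * (t * (a - t^-1))).
    by field; rewrite !gt_eqF.
  rewrite normrN !normrM (gtr0_norm t0) gtr0_norm ?invr_gt0//.
  by rewrite ler_wpM2r// mulr_ge0// ltW.
have -> : \sum_i `|Theta_tilde Bs bh j i - Theta j i| =
    vnorm1 ((a^-1 - t) *: u + a^-1 *: v).
  apply: eq_bigr => i _; rewrite Theta_tildeE -/a -/w; congr (`|_|).
  have -> : Theta j i = t * u i 0.
    by rewrite uE -rowE !mxE mulVKf ?gt_eqF.
  by rewrite wE !mxE; ring.
have v1Z c (x : 'cV[R]_n) : vnorm1 (c *: x) = `|c| * vnorm1 x.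
  by rewrite /vnorm1 mulr_sumr; apply: eq_bigr => i _; rewrite mxE normrM.
apply: le_trans (ler_vnorm1D _ _) _; rewrite !v1Z [`|a^-1|]gtr0_norm ?invr_gt0//.
have r2 : a^-1 * vnorm1 v <= 2 * t * (4 * X * d%:R).
  by rewrite ler_pM ?invr_ge0 ?vnorm1_ge0// ltW.
have r1 : `|a^-1 - t| * vnorm1 u <=
    2 * (delta * s * q + N * X * s * t + 4 * delta * X * d%:R * t) * (s * q).
  apply: (@le_trans _ _ (2 * t * (t * E) * vnorm1 u)).
    by rewrite ler_wpM2r ?vnorm1_ge0.
  rewrite [leLHS](_ : _ = 2 * (t * E) * (t * vnorm1 u)); last by ring.
  rewrite ler_pM//; [|by rewrite mulr_ge0 ?vnorm1_ge0// ltW|by lra].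
  by rewrite !mulr_ge0 ?normr_ge0// ltW.
(* Only the term without a factor [t] trades [q^2] for [T t]; the others use [q <= T]. In the end
   each term carries exactly one [t]. *)
have k1 : 2 * delta * d%:R * q ^+ 2 <= 2 * delta * d%:R * (T * t).
  by rewrite ler_wpM2l// mulr_ge0// mulr_ge0.
have k2 : 2 * N * X * d%:R * t * q <= 2 * N * X * d%:R * t * T.
  by rewrite ler_wpM2l// !mulr_ge0// ltW.
have k3 : 8 * delta * X * s * d%:R * t * q <= 8 * delta * X * s * d%:R * t * T.
  by rewrite ler_wpM2l// !mulr_ge0// ltW.
apply: le_trans (lerD r1 r2) _.
rewrite [leLHS](_ : _ = 2 * delta * s ^+ 2 * q ^+ 2 + 2 * N * X * s ^+ 2 * t * q
  + 8 * delta * X * s * d%:R * t * q + 8 * X * d%:R * t); last by ring.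
by rewrite sd; lra.
Qed.

End Precision.

(** * Spectral and operator-norm bounds for a matrix and its inverse *)

Section Spectrum.
Context {R : realType} (n : nat).
Implicit Types (B : 'M[R]_n).

Lemma eigenvalue_bounds B a : posdef B -> eigenvalue B a ->
  [/\ 0 < a, a <= opnorm2 B & a^-1 <= opnorm2 (invmx B)].
Proof.
move=> Bp /eigenvalueP[x xB x0]; have Bu := posdef_unitmx Bp.
case: Bp => BT Bp; set y := x^T.
have y0 : y != 0 by apply: contraNneq x0 => h; rewrite -(trmxK x) -/y h trmx0.
(* [eigenvalueP] yields a row eigenvector; symmetry makes its transpose a column eigenvector. *)
have By : B *m y = a *: y by rewrite -[B]BT -trmx_mul xB linearZ.
have ny : 0 < vnorm2 y.
  by rewrite lt_def vnorm2_ge0 andbT; apply: contraNneq y0 => /vnorm2_eq0->.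
have a0 : 0 < a.
  by have := Bp _ y0; rewrite /qform By dotpZr -sqr_vnorm2 pmulr_lgt0// exprn_gt0.
have Vy : invmx B *m y = a^-1 *: y.
  by rewrite -[y in LHS](scalerK (lt0r_neq0 a0)) -By -scalemxAr mulKmx.
split=> //; rewrite -(ler_pM2r ny).
  by have := opnorm2_ub B y; rewrite By vnorm2Z gtr0_norm.
by have := opnorm2_ub (invmx B) y; rewrite Vy vnorm2Z gtr0_norm ?invr_gt0.
Qed.

(** Since [inf] of the empty set is 0, positivity of [lambda_min B] already provides an eigenvalue.
    The bounds on single eigenvalues then pass to the infimum. *)
Lemma lambda_min_bounds B : posdef B -> 0 < lambda_min B ->
  lambda_min B <= opnorm2 B /\ (lambda_min B)^-1 <= opnorm2 (invmx B).
Proof.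
move=> Bp l0.
have [a Ea] : [set a : R | eigenvalue B a] !=set0.
  by apply/set0P/eqP => E0; move: l0; rewrite /lambda_min E0 inf0 ltxx.
have [a0 aN aT] := eigenvalue_bounds Bp Ea.
split.
  apply: le_trans aN; apply: ge_inf => //.
  by exists 0 => b /= /(eigenvalue_bounds Bp)[/ltW].
have T0 : 0 < opnorm2 (invmx B) by apply: lt_le_trans aT; rewrite invr_gt0.
rewrite -[leRHS]invrK lef_pV2 ?posrE ?invr_gt0//.
apply: lb_le_inf; first by exists a.
move=> b /= /(eigenvalue_bounds Bp)[b0 _ bT].
by rewrite -[b]invrK lef_pV2 ?posrE ?invr_gt0.
Qed.

(** From [B = W rho W] and its inverse, by submultiplicativity. The bounds are free of [n], which
    lets [r sqrt(d0) -> 0] imply the smallness condition. *)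
Lemma opnorm2_A1 wlo whi Mrho MOmega B : (0 < n)%N -> 0 < wlo -> posdef B ->
  assumption_A1 wlo whi Mrho MOmega B ->
  opnorm2 B <= whi * Mrho * whi /\
  opnorm2 (invmx B) <= wlo^-1 * MOmega * wlo^-1.
Proof.
move=> n0 wlo0 Bp [Wb /andP[_ rM] /andP[_ OM]].
have Bu := posdef_unitmx Bp.
set W := sdmx B; set w : 'rV[R]_n := \row_i Num.sqrt (B i i).
have wb i : wlo <= w 0 i <= whi by have := Wb i; rewrite /sdmx mxE eqxx.
have w0 i : 0 < w 0 i by have /andP[/(lt_le_trans wlo0)] := wb i.
have whi0 : 0 <= whi.
  by have /andP[_] := wb (Ordinal n0); apply: le_trans; exact: ltW.
set V : 'M[R]_n := diag_mx (\row_i (w 0 i)^-1).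
have WV : W *m V = 1%:M.
  rewrite /W /sdmx /V mulmx_diag; apply/matrixP => i k; rewrite !mxE.
  by have := w0 i; rewrite mxE => /lt0r_neq0/mulfV->.
have [Wu VE] : W \in unitmx /\ V = invmx W.
  have [Wu _] := mulmx1_unit WV.
  by split=> //; rewrite -[V](mulKmx Wu) WV mulmx1.
have W_le : opnorm2 W <= whi.
  apply: opnorm2_diag => // i; have /andP[_] := wb i.
  by rewrite -/w gtr0_norm.
have V_le : opnorm2 (invmx W) <= wlo^-1.
  rewrite -VE; apply: opnorm2_diag => [|i]; first by rewrite invr_ge0 ltW.
  have /andP[h _] := wb i.
  by rewrite [_ 0 i]mxE gtr0_norm ?invr_gt0// lef_pV2 ?posrE.
have opM3 (M P Q : 'M[R]_n) c1 c2 c3 : opnorm2 M <= c1 -> opnorm2 P <= c2 ->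
    opnorm2 Q <= c3 -> opnorm2 (M *m P *m Q) <= c1 * c2 * c3.
  move=> Mc Pc Qc; apply: le_trans (opnorm2M _ _) _.
  rewrite ler_pM ?opnorm2_ge0//; apply: le_trans (opnorm2M _ _) _.
  by rewrite ler_pM ?opnorm2_ge0.
split.
  have -> : B = W *m corrmx B *m W.
    by rewrite /corrmx -/W !mulmxA mulmxV// mul1mx mulmxKV.
  exact: opM3.
have -> : invmx B = invmx W *m invmx (corrmx B) *m invmx W.
  rewrite /corrmx -/W.
  have -> : invmx (invmx W *m B *m invmx W) = W *m invmx B *m W.
    have Cu : invmx W *m B *m invmx W \in unitmx.
      by rewrite !unitmx_mul unitmx_inv Wu Bu.
    apply: (can_inj (mulKmx Cu)); rewrite mulmxV//.
    by rewrite !mulmxA mulmxKV// mulmxK// mulVmx.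
  by rewrite !mulmxA mulVmx// mul1mx mulmxK.
exact: opM3.
Qed.

End Spectrum.

(** * Symmetrization and the error of the full estimator *)

Section Estimator.
Context {R : realType} (n : nat).
Implicit Types (B T S : 'M[R]_n).

Lemma symmx_Bstar m (U : 'M[bool]_(n, m)) (X : 'M[R]_(n, m)) :
  symmx (Bstar U X).
Proof.
apply/matrixP => i k; rewrite !mxE (eq_sym k); congr (_ / _).
by apply: eq_bigr => l _; rewrite !mxE mulrC.
Qed.

Lemma symmx_Gammahat B j : symmx B -> symmx (Gammahat B j).
Proof.
move=> BT; apply/matrixP => i k.
by rewrite !mxE -[in LHS]BT mxE.
Qed.

(** [S] itself competes in the projection, so [That] is at least as close to [T] as [S] is, and the
    triangle inequality costs a factor 2. By symmetry, column sums are row sums. *)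
Lemma symm_proj_error T S That c : 0 <= c -> symmx S -> symm_proj T That ->
  (forall j, \sum_i `|T j i - S j i| <= c) -> mxnorm1 (That - S) <= 2 * c.
Proof.
move=> c0 ST [HT /(_ _ ST) Hmin] Tc.
apply: bigmax_le => [|j _]; first by rewrite mulr_ge0.
have -> : \sum_i `|(That - S) i j| = \sum_i `|(That - S) j i|.
  by apply: eq_bigr => i _; rewrite !mxE -[in LHS]HT -[in LHS]ST !mxE.
have H1 : mxnorm_oo (S - T) <= c.
  apply: bigmax_le => // i _; apply: le_trans (Tc i).
  by apply: ler_sum => k _; rewrite !mxE distrC.
have H2 : \sum_i `|(That - T) j i| <= mxnorm_oo (That - T).
  exact: (le_bigmax 0 (fun j => \sum_i `|(That - T) j i|) j).
apply: (@le_trans _ _ (\sum_i `|(That - T) j i| + \sum_i `|T j i - S j i|)).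
  rewrite -big_split ler_sum// => i _; rewrite !mxE.
  exact: ler_distD.
by have := Tc j; lra.
Qed.

(** The lasso bounds feed the row estimate for each [j], and [Theta j j <= tmax] makes it uniform;
    the outer 2 comes from symmetrization. *)
Lemma Theta_hat_error B Bs That (d : nat) (delta lambda b1 alpha tau : R) :
  let Theta := invmx B in
  let s := Num.sqrt d%:R in
  let X := 3 * lambda / alpha in
  let tmax := max_diag Theta in
  posdef B -> symmx Bs -> (row_sparsity Theta <= d)%N ->
  0 < lambda -> 0 < alpha -> 0 <= tau -> 4 * b1 * tau <= lambda ->
  `|Bs - B| <= delta ->
  (forall j, `|gammahat Bs j - Gammahat Bs j *m beta_star Theta j| <= lambda / 4) ->
  (forall j, lower_RE alpha tau (Gammahat Bs j)) ->
  (forall j, vnorm1 (beta_star Theta j) <= b1) ->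
  delta * s * opnorm2 Theta + opnorm2 B * X * s * tmax
    + 4 * delta * X * d%:R * tmax <= 2^-1 ->
  is_Theta_hat Bs lambda b1 That ->
  mxnorm1 (That - Theta) <=
    2 * (2 * delta * d%:R * opnorm2 Theta * tmax
    + 2 * opnorm2 B * X * d%:R * opnorm2 Theta * tmax
    + 8 * delta * X * s * d%:R * opnorm2 Theta * tmax
    + 8 * X * d%:R * tmax).
Proof.
move=> Theta s X tmax Bp BsT rs l0 a0 t0 tb1 BsB gG RE bb small [bh [bhmin projT]].
have Tp : posdef Theta := posdef_inv Bp.
have s0 : 0 <= s := sqrtr_ge0 _.
have XE : X = 3 * lambda / alpha by [].
have X0 : 0 <= X by rewrite divr_ge0 ?mulr_ge0 ?ltW.
clearbody X.
have delta0 : 0 <= delta by apply: le_trans BsB.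
have N0 := opnorm2_ge0 B; have T0 := opnorm2_ge0 Theta.
have tle j : Theta j j <= tmax.
  exact: (le_bigmax 0 (fun j => Theta j j) j).
have tmax0 : 0 <= tmax by exact: bigmax_ge_id.
apply: (symm_proj_error _ _ projT); first by rewrite !addr_ge0// !mulr_ge0.
  by case: Tp.
move=> j.
have dj : (#|[set i | Theta j i != 0%R]%SET| <= d)%N.
  apply: leq_trans rs.
  exact: (leq_bigmax (F := fun j => #|[set i | Theta j i != 0%R]%SET|)).
(* The injection [lift j] embeds this support into that of row [j]. *)
have Sd : (#|[set k | Theta j (lift j k) != 0%R]%SET| <= d)%N.
  apply: leq_trans dj; rewrite -(card_imset _ (@lift_inj _ j)).
  by apply/subset_leq_card/fintype.subsetP => _ /imsetP[k + ->]; rewrite !inE.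
have bS k : k \notin [set k | Theta j (lift j k) != 0%R]%SET ->
    beta_star Theta j k 0 = 0.
  by rewrite inE negbK mxE => /eqP->; rewrite oppr0 mul0r.
have [v2 v1] := lasso_error (symmx_Gammahat j BsT) l0 a0 t0 tb1 (RE j) (gG j)
  bS Sd (bb j) (bhmin j).
have t0j := ltW (posdef_diag_gt0 j Tp).
apply: le_trans (Theta_tilde_row_error Bp dj BsB X0 _ _ _) _.
- by rewrite XE -/s mulrAC ler_pdivlMr// mulrC.
- rewrite [leRHS](_ : _ = 12 * lambda * d%:R / alpha); last by rewrite XE; ring.
  by rewrite ler_pdivlMr// mulrC.
- by apply: le_trans small; rewrite !lerD// ler_wpM2l// !mulr_ge0.
- by rewrite !lerD// ler_wpM2l// !mulr_ge0.
Qed.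

End Estimator.

(** * Arithmetic of the rates *)

Section Rates.
Context {R : realType}.
(* In the application [X = 3 lambda / alpha], [mu = 1 / lambda_min B],
   [N = |B|_2], [T = |Theta|_2], [K = Mrho MOmega] and [th = theta_max]. *)
Context (c0 c1 b K r s d N T mu th X delta : R)
  (c0_ge0 : 0 <= c0) (c1_ge0 : 0 <= c1) (b_ge0 : 0 <= b)
  (K_ge1 : 1 <= K) (r_ge0 : 0 <= r) (s_ge0 : 0 <= s) (dE : d = s ^+ 2)
  (mu_ge0 : 0 <= mu) (th_ge0 : 0 <= th)
  (bN : b <= N) (muT : mu <= T) (cond_ge1 : 1 <= N * mu)
  (deltaE : delta = c0 * b * r) (X_le : X <= c1 * (b * K * r * mu)).

Let T_ge0 : 0 <= T := le_trans mu_ge0 muT.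
Let d_ge0 : 0 <= d.
Proof. by rewrite dE sqr_ge0. Qed.
Let N_ge0 : 0 <= N := le_trans b_ge0 bN.
Let K_ge0 : 0 <= K := le_trans ler01 K_ge1.

(** Each term is compared with the target product [P]: [1 <= K] and [1 <= N mu] supply missing
    factors, [b <= N] and [r s <= 1] absorb the cross term, and [mu <= T] settles the last. The 10
    is 2 + 8. *)
Lemma rate_bound : r * s <= 1 ->
  2 * delta * d * T * th + 2 * N * X * d * T * th
    + 8 * delta * X * s * d * T * th + 8 * X * d * th
  <= (2 * c0 + 10 * c1 + 8 * c0 * c1) * (T * b * K * th * (N * mu) * r * d).
Proof.
move=> rs1; set P := T * b * K * th * (N * mu) * r * d.
have P0 : 0 <= P by rewrite !mulr_ge0.
have nm0 : 0 <= N * mu by rewrite mulr_ge0.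
have t1 : delta * d * T * th <= c0 * P.
  rewrite deltaE [leLHS](_ : _ = c0 * (T * b * th * r * d * (1 * 1))); last by ring.
  rewrite [P](_ : _ = T * b * th * r * d * (K * (N * mu))); last by rewrite /P; ring.
  by rewrite ler_wpM2l// ler_wpM2l ?mulr_ge0// ler_pM.
have t2 : N * X * d * T * th <= c1 * P.
  apply: (@le_trans _ _ (N * (c1 * (b * K * r * mu)) * d * T * th)).
    by do 3 ![rewrite ler_wpM2r//]; rewrite ler_wpM2l.
  by rewrite /P le_eqVlt; apply/orP; left; apply/eqP; ring.
have t3 : delta * X * s * d * T * th <= c0 * c1 * P.
  apply: (@le_trans _ _ (delta * (c1 * (b * K * r * mu)) * s * d * T * th)).
    by do 4 ![rewrite ler_wpM2r//]; rewrite ler_wpM2l// deltaE !mulr_ge0.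
  rewrite deltaE [leLHS](_ : _ =
    c0 * c1 * (T * b * K * th * r * d * (b * mu * (r * s)))); last by ring.
  rewrite [P](_ : _ = T * b * K * th * r * d * (N * mu * 1)); last by rewrite /P; ring.
  by rewrite ler_wpM2l ?mulr_ge0// ler_wpM2l ?mulr_ge0// ler_pM ?mulr_ge0// ler_wpM2r.
have t4 : X * d * th <= c1 * P.
  apply: (@le_trans _ _ (c1 * (b * K * r * T) * d * th)).
    do 2 ![rewrite ler_wpM2r//]; apply: le_trans X_le _.
    by rewrite ler_wpM2l// ler_wpM2l// !mulr_ge0.
  rewrite [leLHS](_ : _ = c1 * (T * b * K * th * r * d * 1)); last by ring.
  rewrite [P](_ : _ = T * b * K * th * r * d * (N * mu)); last by rewrite /P; ring.
  by rewrite ler_wpM2l// ler_wpM2l// !mulr_ge0.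
by lra.
Qed.

(** Crude constants suffice, as long as one factor [r s] comes out of every term; [b <= N0], and
    both [mu] and [th] are at most [T0]. *)
Lemma rate_small N0 T0 : r * s <= 1 -> N <= N0 -> T <= T0 -> th <= T ->
  delta * s * T + N * X * s * th + 4 * delta * X * d * th
  <= (c0 * N0 * T0 + c1 * N0 ^+ 2 * T0 ^+ 2 * K
      + 4 * c0 * c1 * N0 ^+ 2 * T0 ^+ 2 * K) * (r * s).
Proof.
move=> rs1 NN0 TT0 thT.
have bN0 := le_trans bN NN0; have muT0 := le_trans muT TT0.
have thT0 := le_trans thT TT0.
have N00 := le_trans N_ge0 NN0; have T00 := le_trans T_ge0 TT0.
have rs0 : 0 <= r * s by rewrite mulr_ge0.
have t1 : delta * s * T <= c0 * N0 * T0 * (r * s).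
  rewrite deltaE [leLHS](_ : _ = c0 * (b * T) * (r * s)); last by ring.
  by rewrite ler_wpM2r// -[leRHS]mulrA ler_wpM2l// ler_pM.
have t2 : N * X * s * th <= c1 * N0 ^+ 2 * T0 ^+ 2 * K * (r * s).
  apply: (@le_trans _ _ (N * (c1 * (b * K * r * mu)) * s * th)).
    by do 2 ![rewrite ler_wpM2r//]; rewrite ler_wpM2l.
  rewrite [leLHS](_ : _ = c1 * ((N * b) * (mu * th)) * K * (r * s)); last by ring.
  rewrite ler_wpM2r// ler_wpM2r// -[leRHS]mulrA ler_wpM2l// !expr2.
  by rewrite ler_pM ?mulr_ge0// ler_pM.
have t3 : delta * X * d * th <= c0 * c1 * N0 ^+ 2 * T0 ^+ 2 * K * (r * s).
  apply: (@le_trans _ _ (delta * (c1 * (b * K * r * mu)) * d * th)).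
    by do 2 ![rewrite ler_wpM2r//]; rewrite ler_wpM2l// deltaE !mulr_ge0.
  rewrite deltaE dE [leLHS](_ : _ =
    c0 * c1 * ((b * b) * (mu * th)) * K * (r * s) * (r * s)); last by ring.
  (* Two factors [r] pair with [d = s^2] into [(r s)^2]; one [r s] is bounded by 1. *)
  apply: (@le_trans _ _ (c0 * c1 * ((b * b) * (mu * th)) * K * (r * s) * 1)).
    by rewrite ler_wpM2l ?mulr_ge0.
  rewrite mulr1 ler_wpM2r// ler_wpM2r// -[leRHS]mulrA ler_wpM2l ?mulr_ge0// !expr2.
  by rewrite ler_pM ?mulr_ge0// ler_pM.
by lra.
Qed.

End Rates.

(** * Choice of constants and conclusion for large [n] *)

Theorem theorem5p1 (R : realType)
  (Cmax cgamma Cgamma clambda Clambda calpha Calpha : R) :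
  0 < Cmax -> 0 < cgamma -> Num.max cgamma Cmax <= Cgamma ->
  0 < clambda -> 0 < Clambda -> 0 < calpha -> 0 < Calpha ->
  exists coverall : R, 0 < coverall /\
  forall (wlo whi Mrho MOmega : R), 0 < wlo ->
  forall (m : nat -> nat)
    (A0 : forall n, 'M[R]_(m n)) (B0 : forall n, 'M[R]_n)
    (p : forall n, 'I_(m n) -> R),
  let Theta0 := fun n => invmx (B0 n) in
  let r := fun n => r_offd n (A0 n) (@p n) in
  let d0 := fun n => row_sparsity (Theta0 n) in
  (\forall n \near \oo,
     [/\ (0 < m n)%N, posdef (A0 n) & forall j, 0 <= p n j <= 1] /\
     [/\ posdef (B0 n), \tr (B0 n) = n%:R &
         assumption_A1 wlo whi Mrho MOmega (B0 n)]) ->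
  (r n * Num.sqrt (d0 n)%:R @[n --> \oo] --> (0 : R)) ->
  \forall n \near \oo,
  forall (Z : 'M[R]_(n, m n)) (U : 'M[bool]_(n, m n))
    (lambda b1 alpha tau : R) (That : 'M[R]_n),
  let Bs := Bstar U (observed (A0 n) (B0 n) U Z) in
  let binf := max_diag (B0 n) in
  0 < lambda -> 0 < b1 -> 0 < tau ->
  `|Bs - B0 n| <= Cmax * binf * r n ->
  (forall j : 'I_n,
     `|gammahat Bs j - Gammahat Bs j *m beta_star (Theta0 n) j|
       <= cgamma * binf * kappa_rho (B0 n) * r n) ->
  cgamma * binf * kappa_rho (B0 n) * r n <= lambda / 4 ->
  asymp clambda Clambda lambda (4 * Cgamma * binf * (Mrho * MOmega) * r n) ->
  (forall j : 'I_n, lower_RE alpha tau (Gammahat Bs j)) ->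
  asymp calpha Calpha alpha (lambda_min (B0 n)) ->
  120 * (d0 n)%:R <= alpha / tau ->
  4 * b1 <= lambda / tau ->
  (forall j : 'I_n, vnorm1 (beta_star (Theta0 n) j) <= b1) ->
  is_Theta_hat Bs lambda b1 That ->
  mxnorm1 (That - Theta0 n) <=
    coverall * opnorm2 (Theta0 n) * binf * (Mrho * MOmega)
      * max_diag (Theta0 n) * cond_number (B0 n) * r n * (d0 n)%:R.
Proof.
move=> Cmax0 cgamma0 Cgamma_ge clambda0 Clambda0 calpha0 Calpha0.
have Cgamma0 : 0 < Cgamma by apply: lt_le_trans Cgamma_ge; rewrite lt_max cgamma0.
(* Bounds [X = 3 lambda / alpha]: [lambda] gives [4 Cgamma / clambda], [1 / alpha] gives [Calpha],
   and 12 = 3 * 4. *)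
pose c1 : R := 12 * Cgamma * Calpha / clambda.
have c10 : 0 < c1 by rewrite divr_gt0// !mulr_gt0.
exists (2 * (2 * Cmax + 10 * c1 + 8 * Cmax * c1)); split.
  by have := mulr_gt0 Cmax0 c10; lra.
move=> wlo whi Mrho MOmega wlo0 m A0 B0 p Theta0 r d0 hyp rd0.
pose N0 := whi * Mrho * whi; pose T0 := wlo^-1 * MOmega * wlo^-1.
pose K := Mrho * MOmega.
pose C := Cmax * N0 * T0 + c1 * N0 ^+ 2 * T0 ^+ 2 * K
      + 4 * Cmax * c1 * N0 ^+ 2 * T0 ^+ 2 * K.
(* The first bound serves [r s <= 1], the second [C r s <= 1/2]; [|C| + 1] is positive whatever [C]
   is. Only the threshold on [n], not [coverall], depends on [C]. *)
pose eps : R := Num.min 1 ((2 * (`|C| + 1))^-1).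
have C1 : 0 < `|C| + 1 by rewrite ltr_wpDl.
have eps0 : 0 < eps by rewrite lt_min ltr01 invr_gt0 mulr_gt0.
near=> n.
have n0 : (0 < n)%N by near: n; exact: nbhs_infty_gt.
have rsd : r n * Num.sqrt (d0 n)%:R < eps.
  by near: n; exact: (cvgr_lt _ rd0).
have [_ [Bp _ A1]] : [/\ (0 < m n)%N, posdef (A0 n) & forall j, 0 <= p n j <= 1] /\
     [/\ posdef (B0 n), \tr (B0 n) = n%:R &
         assumption_A1 wlo whi Mrho MOmega (B0 n)] by near: n.
move=> Z U lambda b1 alpha tau That.
set Bs := Bstar _ _; set b := max_diag _.
move=> l0 b10 tau0 BsB gG cl asl RE asa ad lb bb HT.
have Tp : posdef (Theta0 n) := posdef_inv Bp.
pose j0 := Ordinal n0.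
(* Diagonal entries of [Theta0 n] are positive, so [d0 n >= 1]; then [120 d0 <= alpha / tau] makes
   [alpha] positive, and with it [lambda_min]. *)
have d0_gt0 : (0 < d0 n)%N.
  apply: (@leq_trans #|[set j | Theta0 n j0 j != 0%R]%SET|); last first.
    exact: (leq_bigmax (F := fun i => #|[set j | Theta0 n i j != 0%R]%SET|)).
  rewrite card_gt0; apply/finset.set0Pn; exists j0.
  by rewrite inE gt_eqF// posdef_diag_gt0.
have alpha0 : 0 < alpha.
  have : 0 < alpha / tau by apply: lt_le_trans ad; rewrite mulr_gt0// ltr0n.
  by rewrite pmulr_lgt0// invr_gt0.
have [N_le T_le] := opnorm2_A1 n0 wlo0 Bp A1.
have K1 : 1 <= K.
  case: A1 => _ /andP[h1 h2] /andP[h3 h4].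
  by rewrite mulr_ege1// ?(le_trans h1 h2)// (le_trans h3 h4).
have /andP[ca aC] := asa.
have lm0 : 0 < lambda_min (B0 n) by apply: lt_le_trans ca; rewrite mulr_gt0.
have [lmN lmT] := lambda_min_bounds Bp lm0.
have r0 : 0 <= r n by rewrite mulr_ge0// sqrtr_ge0.
have diag_bound (M : 'M[R]_n) : 0 <= max_diag M <= opnorm2 M.
  rewrite bigmax_ge_id /= bigmax_le ?opnorm2_ge0// => i _.
  exact: diag_le_opnorm2.
have /andP[b0 bN] := diag_bound (B0 n).
have /andP[th0 thT] := diag_bound (Theta0 n).
have mu0 : 0 <= (lambda_min (B0 n))^-1 by rewrite invr_ge0 ltW.
have cond1 : 1 <= opnorm2 (B0 n) * (lambda_min (B0 n))^-1.
  by rewrite ler_pdivlMr// mul1r.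
have X_le : 3 * lambda / alpha <= c1 * (b * K * r n * (lambda_min (B0 n))^-1).
  have /andP[l1 _] := asl.
  have h1 : lambda <= 4 * Cgamma * b * K * r n / clambda.
    by rewrite ler_pdivlMr// mulrC.
  have h2 : alpha^-1 <= Calpha / lambda_min (B0 n).
    by rewrite ler_pdivlMr// ler_pdivrMl// mulrC.
  rewrite [leRHS](_ : _ = 3 * (4 * Cgamma * b * K * r n / clambda) *
    (Calpha / lambda_min (B0 n))); last first.
    by rewrite /c1; ring.
  apply: ler_pM => //; [by rewrite mulr_ge0// ltW|by rewrite invr_ge0 ltW|].
  by rewrite ler_pM2l.
have s0 : 0 <= Num.sqrt (d0 n)%:R :> R := sqrtr_ge0 _.
have dE : (d0 n)%:R = Num.sqrt (d0 n)%:R ^+ 2 :> R by rewrite sqr_sqrtr.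
have rs1 : r n * Num.sqrt (d0 n)%:R <= 1.
  by apply: ltW; apply: lt_le_trans rsd _; rewrite ge_min lexx.
have rsC : C * (r n * Num.sqrt (d0 n)%:R) <= 2^-1.
  apply: (@le_trans _ _ ((`|C| + 1) * (2 * (`|C| + 1))^-1)).
    apply: (@le_trans _ _ ((`|C| + 1) * (r n * Num.sqrt (d0 n)%:R))).
      apply: ler_wpM2r; first exact: mulr_ge0.
      by apply: le_trans (ler_norm C) _; rewrite lerDl.
    rewrite ler_pM2l//; apply: ltW; apply: lt_le_trans rsd _.
    by rewrite ge_min lexx orbT.
  by rewrite invfM mulrCA mulfV ?mulr1// gt_eqF.
have cg_le j :
    `|gammahat Bs j - Gammahat Bs j *m beta_star (Theta0 n) j| <= lambda / 4.
  by apply: le_trans (gG j) cl.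
have tb1 : 4 * b1 * tau <= lambda by rewrite -ler_pdivlMr.
apply: le_trans (Theta_hat_error Bp (symmx_Bstar _ _) (leqnn _) l0 alpha0 (ltW tau0)
  tb1 BsB cg_le RE bb _ HT) _.
  apply: le_trans rsC.
  by apply: (rate_small (ltW Cmax0) (ltW c10) b0 K1 r0 s0 dE mu0 th0 bN lmT).
rewrite [leRHS](_ : _ = 2 * ((2 * Cmax + 10 * c1 + 8 * Cmax * c1) *
  (opnorm2 (Theta0 n) * b * K * max_diag (Theta0 n)
   * (opnorm2 (B0 n) * (lambda_min (B0 n))^-1) * r n * (d0 n)%:R))); last first.
  by rewrite /cond_number /K; ring.
rewrite ler_pM2l//.
by apply: (rate_bound (ltW Cmax0) (ltW c10) b0 K1 r0 s0 dE mu0 th0 bN lmT).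
Unshelve. all: by end_near. Qed.
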